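(* One has $$2^{n-1}\le N_n(l)\le\frac1{n+1}\binom{2n}{n}$$ for all integer vectors $l=(l_1,\dots,l_{n-1})$ with $j\le l_j\le n-1$ for $j=1,\dots,n-1$. The left-hand inequality is an equality if and only if $l_j=n-1$ for all $j=1,\dots,n-1$, and the right-hand inequality is an equality if and only if $l_j=j$ for all $j=1,\dots,n-1$.
   Context: For a vector $l=(l_1,\dots,l_{n-1})$ of positive integers with $i\le l_i\le n-1$, a nondecreasing $l$-path of length $n$ is an integer-valued path $\{Y_i\}_{i=1}^n$ satisfying $1\le Y_1\le Y_2\le\cdots\le Y_n=n$, with the strict inequality $Y_{i+1}>Y_i$ holding whenever $Y_i\le l_i$ ($1\le i\le n-1$). $N_n(l)$ denotes the number of nondecreasing $l$-paths of length $n$. *)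

(* Defs.v *)
From mathcomp Require Import all_boot all_order all_algebra.

Set Implicit Arguments.
Unset Strict Implicit.
Unset Printing Implicit Defensive.

(* Vectors and paths are sequences with 1-based entries: ent s i is s_i for
   1 <= i <= size s; it is only ever used in that range. *)
Definition ent (s : seq nat) (i : nat) : nat := nth 0 s i.-1.

(* The index i runs over 1, ..., n - 1 in the step condition. *)
Definition is_lpath (n : nat) (l : n.-1.-tuple nat) (Y : n.-tuple nat) : bool :=
  [&& 1 <= ent Y 1,
      ent Y n == n
    & all (fun i => (ent Y i <= ent Y i.+1)
                    && ((ent Y i <= ent l i) ==> (ent Y i < ent Y i.+1)))
          (index_iota 1 n)].

(* An l-path of length n takes its values in {1, ..., n} (see lpath_bounded),
   so it suffices to count the paths with entries in 'I_n.+1 = {0, ..., n}. *)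
Definition num_lpaths (n : nat) (l : n.-1.-tuple nat) : nat :=
  #|[set Y : n.-tuple 'I_n.+1 | is_lpath l [tuple of map val Y]]|.

Lemma lpath_bounded (n : nat) (l : n.-1.-tuple nat) (Y : n.-tuple nat) :
  is_lpath l Y -> exists Z : n.-tuple 'I_n.+1, Y = [tuple of map val Z].
Proof.
case/and3P=> _ /eqP Yn /allP stepY.
have leY i k : 0 < i -> i + k = n -> ent Y i <= n.
  elim: k i => [|k IHk] i i_gt0 Eik.
    by rewrite -(addn0 i) Eik Yn.
  have /andP[le_i _] : (ent Y i <= ent Y i.+1)
      && ((ent Y i <= ent l i) ==> (ent Y i < ent Y i.+1)).
    by apply: stepY; rewrite mem_index_iota i_gt0 -Eik addnS ltnS leq_addr.
  by apply: leq_trans le_i (IHk _ _ _); rewrite // addSn -addnS.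
exists [tuple inord (tnth Y i) | i < n].
apply: eq_from_tnth => i; rewrite tnth_map tnth_mktuple /= inordK // ltnS.
rewrite (tnth_nth 0); apply: (leY i.+1 (n - i.+1)) => //.
exact/subnKC/ltn_ord.
Qed.

(* Main.v *)
Require Import Defs.
From mathcomp Require Import all_boot all_order all_algebra.
From mathcomp Require Import zify.
Import Order.TTheory GRing.Theory Num.Theory.

(** Raising an entry of [l] only adds constraints, so [N_n(l)] is antitone in
    [l]; it lies between its values at [l_j = n - 1] and at [l_j = j].  If
    [l_j < n - 1], the path equal to [i] for [i < j], to [n - 1] at [j] and
    [j + 1], and to [n] afterwards is an [l]-path that is not one for the
    largest vector.  If [l_j > j], the path with [Y_j = j + 1] and [Y_i = i]
    otherwise is one for the smallest vector but not for [l].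

    The two extreme values come from the transfer recursion on the number of
    paths with [k] steps left at height [x], started from a fictitious
    [Y_0 = 0].  With [d = n - x] this number is [2 ^ (d - 1)] (or [1] if
    [d = 0]) in the first case and the ballot number
    [C(k + d, k) - C(k + d, k + 1)] in the second, by the hockey-stick identity. *)

(** * Walks and their transfer recursion *)

Definition lstep (L : nat -> nat) (i x y : nat) : bool :=
  (x <= y) && ((x <= L i) ==> (x < y)).

Fixpoint lwalk (L : nat -> nat) (i x : nat) (s : seq nat) : bool :=
  if s is y :: s' then lstep L i x y && lwalk L i.+1 y s' else true.

(** The index [i] is carried along because the threshold [L i] varies with it. Capping heights at
    [n] loses nothing, since a nondecreasing walk ending at [n] never exceeds it. *)
Fixpoint num_lwalks (n : nat) (L : nat -> nat) (k i x : nat) : nat :=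
  if k is k'.+1 then
    \sum_(y < n.+1 | lstep L i x y) num_lwalks n L k' i.+1 y
  else x == n.

Lemma sum_tuple_cons (T : finType) (k : nat) (F : seq T -> nat) :
  \sum_(t : k.+1.-tuple T) F t = \sum_(x : T) \sum_(t : k.-tuple T) F (x :: t).
Proof.
rewrite pair_big /=.
rewrite (reindex (fun p : T * k.-tuple T => cons_tuple p.1 p.2)) //=.
exists (fun t : k.+1.-tuple T => (thead t, [tuple of behead t])) => [[x t] _|t _] /=.
  by rewrite theadE; congr pair; apply: val_inj.
by rewrite [RHS]tuple_eta; apply: val_inj.
Qed.

Lemma sum_lwalks (n : nat) (L : nat -> nat) (k i x : nat) :
  \sum_(t : k.-tuple 'I_n.+1)
     (lwalk L i x (map val t) && (last x (map val t) == n) : nat)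
  = num_lwalks n L k i x.
Proof.
elim: k i x => [|k IHk] i x /=.
  rewrite (bigD1 [tuple]) //= big1 ?addn0 // => t /eqP[].
  exact: tuple0.
rewrite (@sum_tuple_cons _ _ (fun s =>
  (lwalk L i x (map val s) && (last x (map val s) == n) : nat))) /=.
rewrite [RHS]big_mkcond; apply: eq_bigr => y _.
case: ifP => _ /=; first exact: IHk.
by rewrite big1.
Qed.

Lemma lwalk_all (L : nat -> nat) (i x : nat) (s : seq nat) :
  lwalk L i x s =
  all (fun j => lstep L (i + j) (nth 0 (x :: s) j) (nth 0 s j)) (iota 0 (size s)).
Proof.
elim: s i x => //= y s IHs i x; rewrite addn0 IHs; congr andb.
rewrite -[1]addn0 iotaDl all_map; apply: eq_all => j /=.
by rewrite addSnnS.
Qed.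

(* [L 0] is arbitrary: the step leaving [Y_0 = 0] is strict for every [L]. *)
Lemma is_lpath_lwalk (n : nat) (l : n.-1.-tuple nat) (L : nat -> nat)
    (Y : n.-tuple nat) :
  0 < n -> (forall i, 0 < i < n -> ent l i = L i) ->
  is_lpath l Y = lwalk L 0 0 Y && (last 0 Y == n).
Proof.
move=> n_gt0 lL; rewrite lwalk_all size_tuple /is_lpath.
have -> : last 0 Y = ent Y n by rewrite -nth_last size_tuple.
have -> : iota 0 n = 0 :: index_iota 1 n.
  by case: n n_gt0 {l lL Y} => // n _; rewrite /index_iota subn1.
rewrite /= /lstep leq0n implyTb -andbA; congr andb; rewrite andbC; congr andb.
apply: eq_in_all => -[|i]; rewrite mem_index_iota //= => ilt.
by rewrite add0n -lL.
Qed.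

Lemma num_lpathsE {n : nat} (l : n.-1.-tuple nat) (L : nat -> nat) :
  0 < n -> (forall i, 0 < i < n -> ent l i = L i) ->
  num_lpaths l = num_lwalks n L n 0 0.
Proof.
move=> n_gt0 lL; rewrite -sum_lwalks /num_lpaths -sum1_card big_mkcond /=.
by apply: eq_bigr => Y _; rewrite inE (is_lpath_lwalk _ _ _ _ n_gt0 lL) //=; case: andb.
Qed.

(** * The two extreme counts *)

Lemma sum_ord_rev_leq (n d : nat) (P : pred nat) (F : nat -> nat) :
    d <= n -> (forall y, y <= n -> P y = (n - y <= d)) ->
  \sum_(y < n.+1 | P y) F y = \sum_(j < d.+1) F (n - j).
Proof.
move=> dn PE; rewrite (reindex_inj rev_ord_inj) /=.
rewrite (big_ord_widen n.+1 (fun j => F (n - j))) //.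
apply: eq_big => [j|j _]; last by rewrite subSS.
by have := ltn_ord j; rewrite PE; lia.
Qed.

(** The truncated predecessor gives [j = 0] the value 1, the unit missing from the geometric sum. *)
Lemma sum_pow2_compl (d : nat) : (\sum_(j < d.+1) 2 ^ j.-1) = 2 ^ d.
Proof.
elim: d => [|d IHd]; first by rewrite big_ord1.
by rewrite big_ord_recr IHd /= expnS mul2n addnn.
Qed.

(** Steps below [n] are strict, so a walk is a composition of [n - x] padded by copies of [n];
    [n - x <= k] leaves room for the longest one. *)
Lemma num_lwalks_max (n k i x : nat) :
  0 < n -> x <= n -> n - x <= k ->
  num_lwalks n (fun=> n.-1) k i x = 2 ^ (n - x).-1.
Proof.
move=> n_gt0; elim: k i x => [|k IHk] i x xn xk /=.
  by have -> : x = n by [lia]; rewrite eqxx subnn.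
(* The truncated [(n - x).-1] covers both the strict step from [x < n] and the forced stay at
   [x = n]. *)
rewrite (@sum_ord_rev_leq n (n - x).-1 (lstep (fun=> n.-1) i x)
  (num_lwalks n (fun=> n.-1) k i.+1)) /lstep; [| lia..].
rewrite -sum_pow2_compl; apply: eq_bigr => j _.
have jlt := ltn_ord j; rewrite IHk; [congr (2 ^ _.-1)| |]; lia.
Qed.

(** Pascal's rule telescopes the sum, and [k <= m] makes the initial term ['C(k, m.+1)] vanish. *)
Lemma hockey_stick (k m d : nat) :
  k <= m -> (\sum_(j < d.+1) 'C(k + j, m)) = 'C(k + d.+1, m.+1).
Proof.
move=> km; elim: d => [|d IHd].
  by rewrite big_ord1 addn0 addn1 binS [X in X + _]bin_small.
by rewrite big_ord_recr IHd /= [in RHS]addnS binS.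
Qed.

(** The ballot formula is written additively to avoid truncated subtraction. *)
Lemma num_lwalks_id (n k i x : nat) :
  i + k = n -> i <= x <= n ->
  num_lwalks n id k i x + 'C(k + (n - x), k.+1) = 'C(k + (n - x), k).
Proof.
elim: k i x => [|k IHk] i x ikn ixn /=.
  have -> : x = n by lia.
  by rewrite eqxx subnn.
(* As [i <= x], strictness matters only at [x = i]; there [n - x = k.+1], and the minimum removes
   the choice [y = x]. *)
pose d := minn (n - x) k.
rewrite (@sum_ord_rev_leq n d (lstep id i x) (num_lwalks n id k i.+1));
  [| rewrite /d; lia | rewrite /lstep /d; lia].
have sumE : \sum_(j < d.+1) num_lwalks n id k i.+1 (n - j) + 'C(k + d.+1, k.+2)
    = 'C(k + d.+1, k.+1).
  rewrite -!hockey_stick // -big_split; apply: eq_bigr => j _ /=.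
  have jd : j <= d by rewrite -ltnS.
  have := IHk i.+1 (n - j); rewrite subKn; last by move: jd; rewrite /d; lia.
  by apply; [|move: jd; rewrite /d]; lia.
have [xk|kx] := leqP (n - x) k.
  by move: sumE; rewrite /d (minn_idPl xk) addnS -addSn.
have nxE : n - x = k.+1 by lia.
have dE : d = k by rewrite /d nxE; lia.
(* For [x = i], Pascal's rule on both sides reduces the claim to the symmetry C(2k+1, k+1) = C(2k+1,
   k). *)
move: sumE; rewrite nxE addSn !binS addnA dE => ->; congr addn.
by rewrite -bin_sub; [congr 'C(_, _); lia|lia].
Qed.

Lemma num_lwalks_catalan (n : nat) :
  n.+1 * num_lwalks n id n 0 0 = 'C(2 * n, n).
Proof.
have := @num_lwalks_id n n 0 0 (add0n n) (leq0n n).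
rewrite subn0 addnn -mul2n => wE.
(* Since (n+1) C(2n, n+1) = n C(2n, n), the difference in [wE] times n+1 is a single C(2n, n). *)
have := mul_bin_left (2 * n) n.
have -> : 2 * n - n = n by lia.
by move: wE; move: num_lwalks 'C(_, _.+1) 'C(_, n) => w a b; nia.
Qed.

(** * Monotonicity in [l] and separating paths *)

Lemma is_lpathP {n : nat} (l : n.-1.-tuple nat) (Y : n.-tuple nat) :
  reflect [/\ 0 < ent Y 1, ent Y n = n
    & forall i, 0 < i < n -> lstep (ent l) i (ent Y i) (ent Y i.+1)]
    (is_lpath l Y).
Proof.
apply: (iffP and3P) => [[-> /eqP -> /allP stepY]|[-> -> stepY]]; split=> //.
  by move=> i ilt; apply: stepY; rewrite mem_index_iota.
by apply/allP=> i; rewrite mem_index_iota; apply: stepY.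
Qed.

Lemma is_lpath_antimono {n : nat} (l l' : n.-1.-tuple nat) (Y : n.-tuple nat) :
  (forall j, 0 < j < n -> ent l j <= ent l' j) -> is_lpath l' Y -> is_lpath l Y.
Proof.
move=> ll' /is_lpathP[Y1 Yn stepY]; apply/is_lpathP; split=> // i ilt.
have /andP[leY /implyP lt] := stepY i ilt.
apply/andP; split=> //; apply/implyP => Yil.
exact/lt/(leq_trans Yil)/ll'.
Qed.

Lemma num_lpaths_leq {n : nat} (l l' : n.-1.-tuple nat) :
  (forall j, 0 < j < n -> ent l j <= ent l' j) -> num_lpaths l' <= num_lpaths l.
Proof.
move=> ll'; apply/subset_leq_card/subsetP => Y; rewrite !inE.
exact: is_lpath_antimono.
Qed.

Lemma num_lpaths_ltn {n : nat} (l l' : n.-1.-tuple nat) (Y : n.-tuple nat) :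
    (forall j, 0 < j < n -> ent l j <= ent l' j) ->
  is_lpath l Y -> ~~ is_lpath l' Y -> num_lpaths l' < num_lpaths l.
Proof.
move=> ll' lY l'Y; apply/proper_card/properP; split.
  by apply/subsetP => Z; rewrite !inE; apply: is_lpath_antimono.
have [Z YZ] := lpath_bounded lY.
by exists Z; rewrite inE -YZ.
Qed.

Lemma ent_mktuple (m : nat) (f : nat -> nat) (i : nat) :
  0 < i <= m -> ent [tuple f j.+1 | j < m] i = f i.
Proof.
case: i => // i lt_im; rewrite /ent.
by rewrite -(tnth_nth _ _ (Ordinal lt_im)) tnth_mktuple.
Qed.

Lemma num_lpaths_lt_pred {n : nat} (l l' : n.-1.-tuple nat) (j : nat) :
    (forall i, 0 < i < n -> i <= ent l i <= ent l' i) ->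
    (forall i, 0 < i < n -> ent l' i = n.-1) ->
    0 < j < n -> ent l j < n.-1 ->
  num_lpaths l' < num_lpaths l.
Proof.
move=> ll' l'E jlt ljn.
have ljj : j <= ent l j by have /andP[] := ll' j jlt.
(* The plateau at height [n.-1 > ent l j] is allowed by [l] and forbidden by [l'];
   [j <= ent l j < n.-1] gives [j.+1 < n], so the path can still end at [n]. *)
pose f i := if i < j then i else if i <= j.+1 then n.-1 else n.
apply: (@num_lpaths_ltn _ l l' [tuple f i.+1 | i < n]).
- by move=> i /ll'/andP[].
- apply/is_lpathP; split=> [||i ilt]; rewrite !ent_mktuple /lstep /f; try lia.
  + by do ?case: ifP => ?; lia.
  + by do ?case: ifP => ?; lia.
  + have lin : ent l i <= n.-1 by case/andP: (ll' i ilt); rewrite l'E.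
    have [->|nij] := eqVneq i j; do ?case: ifP => ?; lia.
apply/is_lpathP => -[_ _ /(_ j jlt)].
rewrite !ent_mktuple /lstep /f ?l'E; do ?case: ifP => ?; lia.
Qed.

Lemma num_lpaths_lt_id {n : nat} (l l' : n.-1.-tuple nat) (j : nat) :
    (forall i, 0 < i < n -> ent l i <= ent l' i < n) ->
    (forall i, 0 < i < n -> ent l i = i) ->
    0 < j < n -> j < ent l' j ->
  num_lpaths l' < num_lpaths l.
Proof.
move=> ll' lE jlt jl'.
have l'n : ent l' j < n by have /andP[] := ll' j jlt.
(* The entries at [j] and [j.+1] are both [j.+1], above [ent l j = j] but at most [ent l' j]. *)
pose f i := if i == j then j.+1 else i.
apply: (@num_lpaths_ltn _ l l' [tuple f i.+1 | i < n]).
- by move=> i /ll'/andP[].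
- apply/is_lpathP; split=> [||i ilt]; rewrite !ent_mktuple /lstep /f ?lE; try lia.
  + by do ?case: ifP => ?; lia.
  + by do ?case: ifP => ?; lia.
  + by do ?case: ifP => ?; lia.
apply/is_lpathP => -[_ _ /(_ j jlt)].
rewrite !ent_mktuple /lstep /f; do ?case: ifP => ?; lia.
Qed.

Theorem theorem6 (n : nat) (n_gt0 : 0 < n) (l : n.-1.-tuple nat)
    (hl : forall j : nat, 1 <= j <= n.-1 -> j <= ent l j <= n.-1) :
  (2 ^ n.-1 <= num_lpaths l
   /\ ((num_lpaths l)%:R <= 1 / (n + 1)%:R * 'C(2 * n, n)%:R :> rat)%R)
  /\ (2 ^ n.-1 = num_lpaths l
      <-> forall j : nat, 1 <= j <= n.-1 -> ent l j = n.-1)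
  /\ (((num_lpaths l)%:R = 1 / (n + 1)%:R * 'C(2 * n, n)%:R :> rat)%R
      <-> forall j : nat, 1 <= j <= n.-1 -> ent l j = j).
Proof.
have bndE j : (0 < j < n) = (1 <= j <= n.-1) by lia.
pose lmin := [tuple (i : nat).+1 | i < n.-1].
pose lmax := [tuple n.-1 | i < n.-1].
have lminE j : 0 < j < n -> ent lmin j = j.
  by rewrite bndE; apply: (@ent_mktuple _ id).
have lmaxE j : 0 < j < n -> ent lmax j = n.-1.
  by rewrite bndE; apply: (@ent_mktuple _ (fun=> n.-1)).
have num_max (l' : n.-1.-tuple nat) :
    (forall j, 0 < j < n -> ent l' j = n.-1) -> num_lpaths l' = 2 ^ n.-1.
  by move=> l'E; rewrite (num_lpathsE l' (fun=> n.-1)) // num_lwalks_max // subn0.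
(* Kept general in [l'] to serve both [lmin] in the bound and [l] itself in the converse. *)
have catalanE (l' : n.-1.-tuple nat) : (forall j, 0 < j < n -> ent l' j = j) ->
    (1 / (n + 1)%:R * 'C(2 * n, n)%:R = (num_lpaths l')%:R :> rat)%R.
  move=> l'E; rewrite (num_lpathsE l' id n_gt0 l'E) -num_lwalks_catalan natrM addn1.
  by rewrite mulrA div1r mulVf ?mul1r // pnatr_eq0.
have hl_max j : 0 < j < n -> j <= ent l j <= ent lmax j.
  by move=> jn; rewrite lmaxE // hl // -bndE.
have hl_min j : 0 < j < n -> ent lmin j <= ent l j < n.
  by move=> jn; rewrite lminE //; have := hl j; rewrite -bndE => /(_ jn); lia.
split; [split|split; split].
- by rewrite -(num_max lmax lmaxE); apply: num_lpaths_leq => j /hl_max/andP[].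
- rewrite (catalanE lmin lminE) ler_nat.
  by apply: num_lpaths_leq => j /hl_min/andP[].
(* An entry below [n.-1] would make the count strictly larger, against [eq_num]. *)
- rewrite -(num_max lmax lmaxE) => eq_num j; rewrite -bndE => jn.
  have := hl_max j jn; rewrite lmaxE // => /andP[_].
  rewrite leq_eqVlt => /orP[/eqP //|lt_j].
  by have := num_lpaths_lt_pred l lmax j hl_max lmaxE jn lt_j; rewrite eq_num ltnn.
- by move=> lE; rewrite num_max // => j; rewrite bndE; apply: lE.
- rewrite (catalanE lmin lminE) => /eqP; rewrite eqr_nat => /eqP eq_num j.
  rewrite -bndE => jn; have := hl_min j jn; rewrite lminE // => /andP[+ _].
  rewrite leq_eqVlt => /orP[/eqP //|lt_j].
  by have := num_lpaths_lt_id lmin l j hl_min lminE jn lt_j; rewrite eq_num ltnn.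
- by move=> lE; rewrite (catalanE l) // => j; rewrite bndE; apply: lE.
Qed.
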